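(* Let $n\ge 2$ be an integer and let $\mathbf{p}=(p_1,\ldots,p_n)\in[0,1]^n$ with the probabilities sorted in increasing value, $0\le p_1\le p_2\le\cdots\le p_n\le 1$. Then $$\underline{P}(n,n,\mathbf{p})=\max\left(p_1\left(\sum_{i=2}^{n}p_i-(n-2)\right),\;0\right).$$
   Context: Write $[n]=\{1,\ldots,n\}$ and $K_n=\{(i,j): 1\le i<j\le n\}$. Let $\Theta(\{0,1\}^n)$ be the set of all probability distributions on $\{0,1\}^n$; for $\theta$ in this set, $\tilde{\mathbf{c}}=(\tilde c_1,\ldots,\tilde c_n)$ denotes a random vector with law $\theta$. For $\mathbf{p}\in[0,1]^n$ let $$\Theta(\mathbf{p},p_ip_j;(i,j)\in K_n)=\{\theta\in\Theta(\{0,1\}^n): \mathbb{P}_\theta(\tilde c_i=1)=p_i\ \forall i\in[n],\ \mathbb{P}_\theta(\tilde c_i=1,\tilde c_j=1)=p_ip_j\ \forall (i,j)\in K_n\}.$$ The tightest lower bound on the probability of the intersection of $n$ pairwise independent events is $$\underline{P}(n,n,\mathbf{p})=\min_{\theta\in\Theta(\mathbf{p},p_ip_j;(i,j)\in K_n)}\mathbb{P}_\theta\left(\sum_{i\in[n]}\tilde c_i=n\right).$$ *)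

(* Defs.v *)
From mathcomp Require Import all_boot all_order all_algebra.
From mathcomp Require Import classical_sets reals.

Set Implicit Arguments.
Unset Strict Implicit.
Unset Printing Implicit Defensive.

Import Order.TTheory GRing.Theory Num.Theory.

Local Open Scope classical_set_scope.
Local Open Scope ring_scope.

(* Indices are shifted by one: the paper's [n] = {1, ..., n} is 'I_n.       *)
(* The sample space is {0,1}^n itself, so a distribution theta is a mass    *)
(* function on it and the random vector c~ is the identity.                 *)
Definition cube (n : nat) := {ffun 'I_n -> bool}.

Definition distributions (R : realType) (n : nat) : set {ffun cube n -> R} :=
  [set theta | (forall c, 0 <= theta c) /\ \sum_c theta c = 1].

Definition Pr (R : realType) (n : nat) (theta : {ffun cube n -> R})
    (E : pred (cube n)) : R :=
  \sum_(c | E c) theta c.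

(* Theta(p, p_i p_j; (i,j) in K_n). *)
Definition pairwise_independent (R : realType) (n : nat) (p : 'I_n -> R) :
    set {ffun cube n -> R} :=
  [set theta | [/\ distributions theta,
    forall i : 'I_n, Pr theta (fun c => c i) = p i &
    forall i j : 'I_n, (i < j)%N ->
      Pr theta (fun c => c i && c j) = p i * p j]].

Definition is_minimum (R : realType) (A : set R) (m : R) : Prop :=
  A m /\ lbound A m.

(* The values P_theta(sum_i c~_i = n); c i : bool is coerced to nat.        *)
Definition intersection_probabilities (R : realType) (n : nat)
    (p : 'I_n -> R) : set R :=
  [set Pr theta (fun c => (\sum_(i < n) c i)%N == n)
    | theta in pairwise_independent p].

(* \underline{P}(n, n, p) = v; the minimum is stated as a relation so that  *)
(* its attainment is part of the assertion.                                 *)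
Definition underlineP_eq (R : realType) (n : nat) (p : 'I_n -> R) (v : R) :
    Prop :=
  is_minimum (intersection_probabilities p) v.

(* Main.v *)
Require Import Defs.
From mathcomp Require Import all_boot all_order all_algebra.
From mathcomp Require Import classical_sets reals.
From mathcomp Require Import ring.

Import Order.TTheory GRing.Theory Num.Theory.
Local Open Scope ring_scope.

(** Write [q i = 1 - p i] and let [i0] be the index of the smallest probability.

    Lower bound: on the event [c i0], either all coordinates are 1 or some
    [c i] with [i != i0] is 0, so the union bound gives
    [p i0 <= Pr(all) + \sum_(i != i0) p i0 * q i] (lemma [bonferroni_bound]).

    Attainment: all the distributions needed are mixtures of product Bernoulli
    laws, for which the probability that [c] equals 1 on a set [A] of
    coordinates is the average over the components of the product of their
    parameters on [A] ([Pr_mixture]).  Let [u] be a nonnegative vector with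
    largest entry [a = u i0 <= 1] and [\sum_(i != i0) u i <= 1].  The mixture of
    - the point masses at the vectors whose only zero is at [j], with weights
      [(1 - a) * u j] for every [j],
    - the point mass at the all-ones vector, with weight
      [(1 - a) * (1 - \sum_(i != i0) u i)],
    - the product law with parameters [1 - u i / a], with weight [a ^+ 2]
    has marginals [1 - u i], is pairwise independent, and gives to the all-ones
    vector exactly the weight of the second component, as the third one has
    [c i0 = 0], or weight 0 if [a = 0].  Multiplying each [c i] by an independent Bernoulli variable of
    parameter [g i] keeps pairwise independence and turns the marginals into
    [(1 - u i) * g i]; it only multiplies the parameters of each component by
    [g] ([thinned_mixture]).

    If [\sum_(i != i0) q i <= 1], take [u = q] and [g = 1].  Otherwise divide
    the [q i], [i != i0], by their sum: the all-ones vector then has weight 0,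
    and thinning brings the marginals back down to [p]. *)

(** The event that every coordinate of [c] in [A] is 1. *)
Definition ones_on {n : nat} (A : {set 'I_n}) : pred (cube n) :=
  fun c => [forall i in A, c i].

(** The mixture, with weights [w], of the product Bernoulli laws with
    success probabilities [r k]. *)
Definition mixture {R : realType} {n : nat} {K : finType}
    (w : K -> R) (r : K -> 'I_n -> R) : {ffun cube n -> R} :=
  [ffun c : cube n =>
    \sum_k w k * \prod_i (if c i then r k i else 1 - r k i)].

Lemma eq_Pr {R : realType} {n : nat} {theta : {ffun cube n -> R}}
    {E F : pred (cube n)} : E =1 F -> Pr theta E = Pr theta F.
Proof. by move=> EF; apply: eq_bigl. Qed.

Lemma ones_onT (n : nat) (c : cube n) :
  ((\sum_(i < n) c i)%N == n) = ones_on [set: 'I_n] c.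
Proof.
have le1 i : true -> (c i <= 1 ?= iff c i)%N.
  by move=> _; split; case: (c i).
have := (leqif_sum le1).2; rewrite sum1_card card_ord => ->.
by apply: eq_forallb => i; rewrite inE.
Qed.

Lemma ones_on0 (n : nat) (c : cube n) : ones_on finset.set0 c.
Proof. by apply/forallP => i; rewrite inE. Qed.

Lemma ones_on1 (n : nat) (i : 'I_n) (c : cube n) : ones_on [set i] c = c i.
Proof.
apply/forall_inP/idP => [|ci j /set1P->//].
by apply; rewrite inE.
Qed.

Lemma ones_on2 (n : nat) (i j : 'I_n) (c : cube n) :
  ones_on [set i; j] c = c i && c j.
Proof.
apply/forall_inP/andP => [h|[ci cj] k /set2P[]->//].
by split; apply: h; rewrite !inE eqxx ?orbT.
Qed.

Lemma Pr_product (R : realType) (n : nat) (r : 'I_n -> R) (A : {set 'I_n}) :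
  \sum_(c : cube n | ones_on A c) \prod_i (if c i then r i else 1 - r i) =
  \prod_(i in A) r i.
Proof.
pose F i (b : bool) : R :=
  if (i \in A) && ~~ b then 0 else if b then r i else 1 - r i.
transitivity (\sum_(c : cube n) \prod_i F i (c i)).
  rewrite big_mkcond; apply: eq_bigr => c _; case: ifPn => [|/forall_inPn].
    move/forall_inP => cA; apply: eq_bigr => i _; rewrite /F.
    by case: (boolP (_ && ~~ _)) => // /andP[/cA->].
  by case=> i iA ci; rewrite (bigD1 i) //= /F iA ci mul0r.
rewrite -bigA_distr_bigA [RHS]big_mkcond; apply: eq_bigr => i _.
rewrite big_bool /F; case: (i \in A) => /=; first by rewrite addr0.
by rewrite addrC subrK.
Qed.

Lemma Pr_mixture (R : realType) (n : nat) (K : finType) (w : K -> R)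
    (r : K -> 'I_n -> R) (A : {set 'I_n}) :
  Pr (mixture w r) (ones_on A) = \sum_k w k * \prod_(i in A) r k i.
Proof.
rewrite /Pr; under eq_bigr => c _ do rewrite ffunE.
rewrite exchange_big; apply: eq_bigr => k _.
by rewrite -mulr_sumr Pr_product.
Qed.

Lemma distributions_mixture (R : realType) (n : nat) (K : finType) (w : K -> R)
    (r : K -> 'I_n -> R) :
  (forall k, 0 <= w k) -> \sum_k w k = 1 ->
  (forall k i, 0 <= r k i <= 1) -> distributions (mixture w r).
Proof.
move=> w0 w1 r01; split=> [c|].
  rewrite ffunE; apply: sumr_ge0 => k _; apply: mulr_ge0 => //.
  apply: prodr_ge0 => i _; have /andP[r0 r1] := r01 k i.
  by case: (c i); rewrite ?subr_ge0.
transitivity (Pr (mixture w r) (ones_on finset.set0)).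
  by apply: eq_bigl => c; rewrite ones_on0.
by rewrite Pr_mixture; under eq_bigr => k _ do rewrite big_set0 mulr1.
Qed.

(** The attainment half: the pairwise independent law with marginals
    [1 - u i], thinned by independent Bernoulli variables of parameters [g i].
    Both the marginals and the probability of the all-ones vector are explicit. *)
Lemma thinned_mixture {R : realType} {n : nat} (i0 : 'I_n)
    (u g p : 'I_n -> R) :
  (forall i, 0 <= u i <= u i0) -> u i0 <= 1 ->
  \sum_(i | i != i0) u i <= 1 ->
  (forall i, 0 <= g i <= 1) ->
  (forall i, p i = (1 - u i) * g i) ->
  exists2 theta, pairwise_independent p theta &
    Pr theta (ones_on [set: 'I_n]) =
      (1 - u i0) * (1 - \sum_(i | i != i0) u i) * \prod_i g i.
Proof.
move=> u0a a1 S1 g01 pE; set S := \sum_(i | _) u i; set a := u i0.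
(* Component [inl j] has its only zero at [j], [inr true] has no zero, and
   [inr false] is the product law. *)
pose w (k : 'I_n + bool) : R :=
  match k with
  | inl j => (1 - a) * u j
  | inr true => (1 - a) * (1 - S)
  | inr false => a ^+ 2
  end.
pose s (k : 'I_n + bool) (i : 'I_n) : R :=
  match k with
  | inl j => (i != j)%:R
  | inr true => 1
  | inr false => 1 - u i / a
  end.
pose r k i := s k i * g i.
have a0 : 0 <= a by have /andP[] := u0a i0.
have sumu : \sum_i u i = a + S by rewrite (bigD1 i0).
(* If [a = 0] then [u = 0], so the value of [u i / 0] is irrelevant. *)
have aua i : a * (u i / a) = u i.
  have [a00|an0] := eqVneq a 0; last by rewrite mulrC divfK.
  by rewrite a00 mul0r; apply/eqP; rewrite eq_sym eq_le -{1}a00 andbC u0a.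
have s01 k i : 0 <= s k i <= 1.
  case: k => [j|[]] /=; rewrite ?lexx ?ler01 //.
    by case: (i != j); rewrite ?lexx ?ler01.
  have /andP[ui0 uia] := u0a i.
  have [a00|an0] := eqVneq a 0; first by rewrite a00 invr0 mulr0 subr0 lexx ler01.
  have ap : 0 < a by rewrite lt_def an0.
  by rewrite subr_ge0 ler_pdivrMr // mul1r uia lerBlDr lerDl divr_ge0.
have r01 k i : 0 <= r k i <= 1.
  have /andP[s0 s1] := s01 k i; have /andP[g0 g1] := g01 i.
  by rewrite mulr_ge0 // mulr_ile1.
have w0 k : 0 <= w k.
  case: k => [j|[]] /=; rewrite ?sqr_ge0 // mulr_ge0 ?subr_ge0 //.
  by have /andP[] := u0a j.
(* Thinning factors out of every joint moment. *)
have PrE A : Pr (mixture w r) (ones_on A) =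
    ((1 - a) * (\sum_j u j * \prod_(i in A) (i != j)%:R) + (1 - a) * (1 - S) +
     a ^+ 2 * \prod_(i in A) (1 - u i / a)) * \prod_(i in A) g i.
  rewrite Pr_mixture.
  have -> : \sum_k w k * \prod_(i in A) r k i =
      \sum_k (w k * \prod_(i in A) s k i) * \prod_(i in A) g i.
    by apply: eq_bigr => k _; rewrite -mulrA -big_split.
  rewrite -mulr_suml big_sumType big_bool /= big1_eq mulr1 addrA.
  by rewrite mulr_sumr; under eq_bigr => j _ do rewrite -mulrA.
have sumN1 i : \sum_j u j * (i != j)%:R = a + S - u i.
  rewrite -sumu [in RHS](bigD1 i) //= [LHS](bigD1 i) //= eqxx mulr0 add0r.
  rewrite [RHS]addrAC subrr add0r; apply: eq_bigr => j; rewrite eq_sym => ->.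
  by rewrite mulr1.
exists (mixture w r); first split.
- apply: distributions_mixture => //.
  by rewrite big_sumType big_bool /= -mulr_sumr sumu; ring.
- move=> i; rewrite -(eq_Pr (ones_on1 _ i)) PrE !big_set1 pE.
  under eq_bigr => j _ do rewrite big_set1.
  by rewrite sumN1; have := aua i; move: (u i / a) => v <-; ring.
- move=> i j ltij; rewrite -(eq_Pr (ones_on2 _ i j)) PrE.
  have nij : i != j by rewrite neq_ltn ltij.
  have prod2 (F : 'I_n -> R) : \prod_(k in [set i; j]) F k = F i * F j.
    by rewrite big_setU1 ?big_set1 // inE.
  rewrite !prod2 !pE.
  have -> : \sum_k u k * \prod_(l in [set i; j]) (l != k)%:R =
      a + S - u i - u j.
    rewrite -sumu [in RHS](bigD1 i) //= [LHS](bigD1 i) //= prod2 eqxx mul0r.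
    rewrite mulr0 add0r (addrC (u i)) addrK.
    have nji : j != i by rewrite eq_sym.
    rewrite [in RHS](bigD1 j) //= [LHS](bigD1 j) //= prod2 eqxx !mulr0.
    rewrite add0r [RHS]addrAC subrr add0r; apply: eq_bigr => k /andP[ki kj].
    by rewrite prod2 ![_ == k]eq_sym ki kj !mulr1.
  have := aua i; have := aua j; move: (u i / a) (u j / a) => v v' <- <-.
  ring.
- rewrite PrE big1 ?mulr0 ?add0r; last first.
    by move=> j _; rewrite (bigD1 j) ?inE //= eqxx mul0r mulr0.
  have a2 : a ^+ 2 * (1 - u i0 / a) = 0.
    by rewrite expr2 -mulrA mulrBr mulr1 aua subrr mulr0.
  rewrite [\prod_(i in _) (1 - _)](bigD1 i0) ?inE //= mulrA a2 mul0r addr0.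
  by congr (_ * _); apply: eq_bigl => i; rewrite inE.
Qed.

(** The union bound for [c i0 -> ones_on setT c \/ exists i != i0, ~~ c i],
    each term [Pr (c i0 && ~~ c i)] being [p i0 * (1 - p i)]. *)
Lemma bonferroni_bound (R : realType) (n : nat) (i0 : 'I_n) (p : 'I_n -> R)
    (theta : {ffun cube n -> R}) :
  pairwise_independent p theta ->
  p i0 * (1 - \sum_(i | i != i0) (1 - p i)) <=
    Pr theta (ones_on [set: 'I_n]).
Proof.
case=> -[theta0 _] marg pair.
have {}pair i : i != i0 -> Pr theta (fun c => c i0 && c i) = p i0 * p i.
  rewrite neq_ltn => /orP[/pair|/pair//]; rewrite mulrC => <-.
  by apply: eq_Pr => c; rewrite andbC.
rewrite mulrBr mulr1 mulr_sumr lerBlDr.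
have -> : \sum_(i | i != i0) p i0 * (1 - p i) =
    \sum_(i | i != i0) Pr theta (fun c => c i0 && ~~ c i).
  apply: eq_bigr => i /pair; rewrite mulrBr mulr1 => <-.
  rewrite -marg /Pr (bigID (fun c : cube n => c i)) /=.
  by rewrite [LHS]addrAC subrr add0r.
rewrite -marg /Pr; under [X in _ + X]eq_bigr => i _ do rewrite big_mkcond /=.
rewrite exchange_big /= [leLHS]big_mkcond [X in X + _]big_mkcond.
rewrite -big_split /=.
apply: ler_sum => c _.
have sum0 : 0 <= \sum_(i | i != i0) (if c i0 && ~~ c i then theta c else 0).
  by apply: sumr_ge0 => i _; case: ifP.
case: (boolP (c i0)) sum0 => [ci0 sum0|_ sum0]; last first.
  by apply: addr_ge0 => //; case: (ones_on _ c).
case: (boolP (ones_on _ c)) => [_|/forall_inPn[i _ nci]].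
  by rewrite lerDl.
rewrite add0r (bigD1 i) /=; last by apply: contraNneq nci => ->.
by rewrite nci lerDl; apply: sumr_ge0 => j _; case: (~~ c j).
Qed.

(** Only the minimality of [p i0] matters, not the order of the other
    probabilities. *)
Lemma underlineP_formula (R : realType) (n : nat) (i0 : 'I_n) (p : 'I_n -> R) :
  (forall i, 0 <= p i <= 1) -> (forall i, p i0 <= p i) ->
  underlineP_eq p (Num.max (p i0 * (1 - \sum_(i | i != i0) (1 - p i))) 0).
Proof.
move=> p01 p_min; set S := \sum_(i | _) _.
have p0 i : 0 <= p i by have /andP[] := p01 i.
have p1 i : p i <= 1 by have /andP[] := p01 i.
split; last first.
  move=> _ [theta indep <-]; rewrite (eq_Pr (ones_onT n)) ge_max.
  rewrite bonferroni_bound //=; case: indep => -[theta0 _] _ _.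
  by apply: sumr_ge0.
suff [theta indep PrE] : exists2 theta, pairwise_independent p theta &
    Pr theta (ones_on [set: 'I_n]) = Num.max (p i0 * (1 - S)) 0.
  by exists theta => //; rewrite (eq_Pr (ones_onT n)).
have [S1|S1] := leP S 1.
  have [||||i|theta indep PrE] :=
    thinned_mixture i0 (fun i => 1 - p i) (fun=> 1) p.
  - by move=> i; rewrite subr_ge0 p1 lerB.
  - by rewrite lerBlDr lerDl.
  - by [].
  - by move=> i; rewrite ler01 lexx.
  - by rewrite mulr1 subKr.
  exists theta => //; rewrite PrE big1_eq mulr1 subKr.
  by rewrite max_l // mulr_ge0 // subr_ge0.
have Sp : 0 < S by apply: lt_trans S1.
pose u i := if i == i0 then 1 - p i else (1 - p i) / S.
have u0 i : 0 <= u i.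
  by rewrite /u; case: ifP; rewrite ?divr_ge0 ?subr_ge0 // ltW.
have uq i : u i <= 1 - p i.
  rewrite /u; case: ifP => // _; rewrite ler_pdivrMr // ler_peMr ?subr_ge0 //.
  exact: ltW.
have pu i : p i <= 1 - u i by rewrite lerBrDr addrC -lerBrDr.
have sumu : \sum_(i | i != i0) u i = 1.
  rewrite (eq_bigr (fun i => (1 - p i) / S)) => [|i /negPf ni]; last first.
    by rewrite /u ni.
  by rewrite -mulr_suml divff // gt_eqF.
have ui0 : u i0 = 1 - p i0 by rewrite /u eqxx.
(* Where [1 - u i] vanishes, so does [p i], and the quotient [g i] is 0. *)
have [||||i|theta indep PrE] :=
  thinned_mixture i0 u (fun i => p i / (1 - u i)) p.
- move=> i; rewrite u0 ui0 /=; apply: le_trans (uq i) _.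
  by rewrite lerB.
- by rewrite ui0 lerBlDr lerDl.
- by rewrite sumu.
- move=> i; have v0 : 0 <= 1 - u i by apply: le_trans (pu i).
  rewrite divr_ge0 //=.
  have [->|vn0] := eqVneq (1 - u i) 0; first by rewrite invr0 mulr0 ler01.
  by rewrite ler_pdivrMr ?mul1r // lt_def vn0.
- have [v0|vn0] := eqVneq (1 - u i) 0; last by rewrite mulrC divfK.
  by rewrite v0 mul0r; apply/eqP; rewrite eq_le p0 -{1}v0 pu.
exists theta => //; rewrite PrE sumu subrr mulr0 mul0r max_r //.
by rewrite mulr_ge0_le0 // subr_le0 ltW.
Qed.

Theorem corollary2p9 (R : realType) (n : nat) (hn : (2 <= n)%N)
    (p : 'I_n -> R)
    (p01 : forall i : 'I_n, 0 <= p i <= 1)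
    (p_sorted : forall i j : 'I_n, (i <= j)%N -> p i <= p j) :
  underlineP_eq p
    (Num.max
       (p (Ordinal (ltnW hn)) * (\sum_(i < n | (0 < i)%N) p i - (n - 2)%:R))
       0).
Proof.
set i0 := Ordinal (ltnW hn).
have -> : \sum_(i < n | (0 < i)%N) p i - (n - 2)%:R =
    1 - \sum_(i | i != i0) (1 - p i).
  have -> : \sum_(i < n | (0 < i)%N) p i = \sum_(i | i != i0) p i.
    by apply: eq_bigl => i; rewrite -val_eqE lt0n.
  rewrite sumrB sumr_const cardC1 card_ord.
  rewrite natrB // -subn1 natrB ?(ltnW hn) //; ring.
by apply: underlineP_formula => // i; apply: p_sorted.
Qed.
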